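(* Let $H$ be a complex Hilbert space and let $A,B,T$ be operators in $H$ such that $A$ is normal (not necessarily bounded), $B\in B(H)$ is bounded and self-adjoint, and $T$ is self-adjoint (not necessarily bounded). Then \[T\subset AB\Longrightarrow T=AB.\]
   Context: Operators are linear, not necessarily bounded, with domain $D(\cdot)\subset H$ a linear subspace. $B(H)$ is the set of bounded operators defined on all of $H$. $S\subset T$ means $D(S)\subset D(T)$ and $Sx=Tx$ for all $x\in D(S)$. The product $ST$ has domain $D(ST)=\{x\in D(T): Tx\in D(S)\}$ and $(ST)x=S(Tx)$. A densely defined operator $S$ is self-adjoint if $S=S^*$. $S$ is normal if it is densely defined, closed and $SS^*=S^*S$ (equality including domains). *)

(* Defs.v *)
From mathcomp Require Import all_boot all_order all_algebra.
From mathcomp Require Export sesquilinear complex.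
From mathcomp Require Import all_classical all_reals all_analysis.
Export numFieldNormedType.Exports.

Set Implicit Arguments.
Unset Strict Implicit.
Unset Printing Implicit Defensive.

Import Order.TTheory GRing.Theory Num.Theory.
Local Open Scope classical_set_scope.
Local Open Scope ring_scope.
Local Open Scope complex_scope.

(* Complex scalars are [R[i]] for [R : realType]. A complex Hilbert space is a
   complete normed module over [R[i]] with an inner product [dot] (linear in its
   first argument) that induces the norm. *)
Definition induces_norm (R : realType) (H : completeNormedModType R[i])
    (dot : {dot H for Num.conj}) : Prop :=
  forall x : H, `|x| ^+ 2 = dot x x.

(* A partially defined map [H -> H]; the values of [opfun] outside [dom] are
   junk, so that two operators are compared with [opeq], not with Leibniz
   equality. *)
Record operator (R : realType) (H : completeNormedModType R[i]) := Operator {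
  dom : set H;
  opfun :> H -> H
}.

Section Operators.
Variables (R : realType) (H : completeNormedModType R[i]).
Implicit Types S T : operator H.

Definition linear_operator S : Prop :=
  [/\ dom S 0,
      forall (a : R[i]) (x y : H), dom S x -> dom S y -> dom S (a *: x + y) &
      forall (a : R[i]) (x y : H), dom S x -> dom S y ->
        S (a *: x + y) = a *: S x + S y].

Definition opsub S T : Prop :=
  dom S `<=` dom T /\ (forall x, dom S x -> S x = T x).

Definition opeq S T : Prop :=
  dom S = dom T /\ (forall x, dom S x -> S x = T x).

Definition opmul S T : operator H :=
  Operator [set x | dom T x /\ dom S (T x)] (fun x => S (T x)).

Definition densely_defined S : Prop := dense (dom S).

Definition graph S : set (H * H) :=
  [set p | dom S p.1 /\ p.2 = S p.1].

Definition closed_operator S : Prop := closed (graph S).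

Definition bounded_operator S : Prop :=
  dom S = setT /\ exists M : R, forall x : H, `|S x| <= M%:C * `|x|.

Variable dot : {dot H for Num.conj}.

Definition is_adjoint_value S (y z : H) : Prop :=
  forall x, dom S x -> dot (S x) y = dot x z.

(* The value at [y] is the unique [z] with [is_adjoint_value S y z]; uniqueness
   ([adjoint_unique]) requires [S] to be densely defined, and [adjoint] is only
   meaningful in that case. *)
Definition adjoint S : operator H :=
  Operator [set y | exists z, is_adjoint_value S y z]
           (fun y => xget 0 [set z | is_adjoint_value S y z]).

Definition selfadjoint S : Prop :=
  densely_defined S /\ opeq S (adjoint S).

Definition normal_operator S : Prop :=
  [/\ densely_defined S, closed_operator S &
      opeq (opmul S (adjoint S)) (opmul (adjoint S) S)].

Lemma adjointP S y : dom (adjoint S) y -> is_adjoint_value S y (adjoint S y).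
Proof. by move=> [z Sz]; rewrite /adjoint /=; case: xgetP => [w _ //|/(_ z)]. Qed.

Lemma adjoint_unique S y z z' : induces_norm dot -> densely_defined S ->
  is_adjoint_value S y z -> is_adjoint_value S y z' -> z = z'.
Proof.
move=> dotE dS Sz Sz'; apply/eqP; rewrite -subr_eq0; apply/negPn/negP => w0.
set w := z - z' in w0.
have [x [/= xw Dx]] : ball w `|w| `&` dom S !=set0.
  apply: dS; last by apply: ball_open; rewrite normr_gt0.
  by exists w; apply: ballxx; rewrite normr_gt0.
have xw0 : dot x w = 0 by rewrite linearB /= -Sz// -Sz'// subrr.
have wx0 : dot w x = 0 by rewrite hermC /= expr0 mul1r xw0 conjC0.
move: xw; rewrite -ball_normE /ball_ /=.
have -> : (`|w - x| < `|w|) = (`|w - x| ^+ 2 < `|w| ^+ 2) by rewrite ltr_pXn2r ?nnegrE.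
clearbody w.
have -> : `|w - x| ^+ 2 = `|w| ^+ 2 + `|x| ^+ 2.
  by rewrite !dotE [dot (w - x) (w - x)]linearB /= !linearBl /= xw0 wx0 subr0 sub0r opprK.
by rewrite gtrDl; apply/negP; rewrite -real_leNgt ?exprn_ge0 ?num_real ?realX ?normr_real.
Qed.

End Operators.

(* Main.v *)
Require Import Defs.
From mathcomp Require Import all_boot all_order all_algebra.
From mathcomp Require Import all_classical all_reals all_analysis.
From mathcomp Require Import ring lra.
Import Order.TTheory GRing.Theory Num.Theory.
Local Open Scope classical_set_scope.
Local Open Scope ring_scope.
Local Open Scope complex_scope.

Set Implicit Arguments.
Unset Strict Implicit.
Unset Printing Implicit Defensive.

(** Why the theorem is true.

    All arguments are carried out with the real inner product [Re <x, y>]; since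
    domains are complex subspaces, an adjoint relation for [Re <., .>] is an
    adjoint relation for the complex product ([real_adjoint_value]).

    Taking adjoints in [T `<=` A B] gives [B A^* `<=` T `<=` A B]
    ([adjoint_product_sub], [intertwining]), so that [B] intertwines [A^*] and
    [A]. Suppose that there are closed subspaces [L_e], with orthogonal
    projections tending strongly to the identity as [e] tends to [0], that lie
    in the domains of [A] and [A^*] and are invariant under [A], [A^*] and [B].
    Let [x] be in the domain of [A B], and split [x = p + q] along [L_e] and its
    complement. Then [T p = B A^* p = A B p], and [A B q] is orthogonal to [L_e].
    For [y] in the domain of [T], [Re <T y, x> - Re <y, A B x>] is therefore
    [Re <T y, q> - Re <y, A B q>], which tends to [0] ([product_symmetric]).
    Hence [x] is in the domain of [T^* = T].

    The spaces [L_e] are the spectral subspaces of [Q = (1 + A^* A)^-1] for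
    [[e, 1]]. The spectral theorem is not needed to construct them. The operator
    [Q] comes from projecting on the graph of [A] ([resolvent_exists]), and by
    normality it commutes with [A] and [A^*] ([compatible_normal],
    [compatible_adjoint]). The absolute value of [Q - e] is obtained from the
    square root of a contraction ([sqrt_contraction]); its positive and negative
    parts ([splitting_exists]) give the subspace [ker (Q - e)_-], on which
    [e (|z|^2 + |A z|^2) <= |z|^2], and a complement, on which the opposite
    inequality holds ([kerU_bound], [kerV_bound]).

    No commutation of [B] with [Q] is available in advance. It is replaced by a
    growth argument ([kerU_intertwine]): the relation [A^k B = B A^*^k] bounds
    the growth of [A^k B x] by that of [A^*^k x], and a component of [B x]
    outside [ker (Q - e')_-], for [e' < e], would grow faster than that. So [B]
    maps [ker (Q - e)_-] into [ker (Q - e')_-] for all [e' < e], and the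
    intersections [L_e] of these kernels over [e' < e] are invariant under
    [B]. *)

(** * The underlying real Hilbert space *)

Section RealPart.
Variables (R : realType) (H : completeNormedModType R[i]).
Variable dot : {dot H for Num.conj}.
Implicit Types (x y z : H) (a b : R).

(** The real inner product [Re <x, y>]. *)
Definition rdot x y : R := complex.Re (dot x y).

(** The norm as a real number, the norm of the space being [R[i]]-valued. *)
Definition rnorm x : R := complex.Re `|x|.

Lemma normE x : `|x| = (rnorm x)%:C.
Proof. by rewrite /rnorm RRe_real // normr_real. Qed.

Lemma rnorm_ge0 x : 0 <= rnorm x.
Proof. by rewrite -lecR -normE normr_ge0. Qed.

Lemma rnorm0 : rnorm 0 = 0.
Proof. by apply: complexI; rewrite -normE normr0. Qed.

Lemma rnorm_eq0 x : rnorm x = 0 -> x = 0.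
Proof. by move=> x0; apply/normr0_eq0; rewrite normE x0. Qed.

Lemma rnormD x y : rnorm (x + y) <= rnorm x + rnorm y.
Proof. by rewrite -lecR rmorphD /= -!normE ler_normD. Qed.

Lemma rnormN x : rnorm (- x) = rnorm x.
Proof. by rewrite /rnorm normrN. Qed.

Lemma rnormB x y : rnorm (x - y) <= rnorm x + rnorm y.
Proof. by rewrite -(rnormN y) rnormD. Qed.

Lemma rnormZ a x : rnorm (a%:C *: x) = `|a| * rnorm x.
Proof.
apply: complexI; rewrite -normE normrZ rmorphM /= -normE; congr (_ * _).
by rewrite normc_def /= expr0n addr0 sqrtr_sqr.
Qed.

Lemma rdotDl x y z : rdot (x + y) z = rdot x z + rdot y z.
Proof. by rewrite /rdot linearDl raddfD. Qed.

Lemma rdotNl x z : rdot (- x) z = - rdot x z.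
Proof. by rewrite /rdot linearNl raddfN. Qed.

Lemma rdotC x y : rdot x y = rdot y x.
Proof. by rewrite /rdot hermC /= expr0 mul1r; case: (dot y x). Qed.

Lemma rdotZl a x z : rdot (a%:C *: x) z = a * rdot x z.
Proof. by rewrite /rdot linearZl_LR /=; case: (dot x z) => u v /=; rewrite mul0r subr0. Qed.

Lemma rdotDr x y z : rdot z (x + y) = rdot z x + rdot z y.
Proof. by rewrite !(rdotC z) rdotDl. Qed.

Lemma rdotNr x z : rdot z (- x) = - rdot z x.
Proof. by rewrite !(rdotC z) rdotNl. Qed.

Lemma rdotZr a x z : rdot z (a%:C *: x) = a * rdot z x.
Proof. by rewrite !(rdotC z) rdotZl. Qed.

Lemma rdot0l z : rdot 0 z = 0.
Proof. by rewrite -(subrr z) rdotDl rdotNl subrr. Qed.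

Lemma rdot0r z : rdot z 0 = 0.
Proof. by rewrite rdotC rdot0l. Qed.

(** Expansion of inner products of real linear combinations. Vector identities are
    proved with it from [rdot_ext] below. *)
Definition rdotE :=
  (rdotDl, rdotDr, rdotNl, rdotNr, rdotZl, rdotZr, rdot0l, rdot0r).

Hypothesis dot_norm : induces_norm dot.

Lemma rdotxx x : rdot x x = rnorm x ^+ 2.
Proof.
apply: complexI; rewrite rmorphXn /= -normE dot_norm /rdot RRe_real //.
by rewrite -dot_norm realX // normr_real.
Qed.

Lemma rdot_ext x y : (forall z, rdot x z = rdot y z) -> x = y.
Proof.
move=> xy; apply/eqP; rewrite -subr_eq0; apply/eqP/rnorm_eq0/eqP.
by rewrite -sqrf_eq0 -rdotxx rdotDl rdotNl xy subrr.
Qed.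

Lemma rnorm_sq_le x c : 0 <= c -> rdot x x <= c ^+ 2 -> rnorm x <= c.
Proof. by move=> c0; rewrite rdotxx ler_pXn2r // nnegrE rnorm_ge0. Qed.

Lemma rdot_ge0 x : 0 <= rdot x x.
Proof. by rewrite rdotxx sqr_ge0. Qed.

Lemma rdot_le0 x : rdot x x <= 0 -> x = 0.
Proof.
rewrite rdotxx => x0; apply/rnorm_eq0/eqP.
by rewrite -sqrf_eq0 eq_le x0 sqr_ge0.
Qed.

Lemma rdot_CS x y : `|rdot x y| <= rnorm x * rnorm y.
Proof.
have key u v : rdot u v <= rnorm u * rnorm v.
  have [/rnorm_eq0 -> | u0] := eqVneq (rnorm u) 0; first by rewrite rdot0l rnorm0 mul0r.
  have [/rnorm_eq0 -> | v0] := eqVneq (rnorm v) 0; first by rewrite rdot0r rnorm0 mulr0.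
  have up : 0 < rnorm u by rewrite lt0r u0 rnorm_ge0.
  have vp : 0 < rnorm v by rewrite lt0r v0 rnorm_ge0.
  (* equality in Cauchy-Schwarz holds when [w = 0] *)
  set w := (rnorm v)%:C *: u - (rnorm u)%:C *: v.
  have := rdot_ge0 w.
  rewrite /w !rdotE !rdotxx (rdotC v u) => h.
  rewrite -(ler_pM2l (mulr_gt0 up vp)).
  nra.
rewrite ler_norml key andbT lerNl -rdotNl.
by rewrite -(rnormN x) key.
Qed.

End RealPart.

(** * Convergence, real linear maps and closed relations *)

Section Convergence.
Variables (R : realType) (H : completeNormedModType R[i]).
Implicit Types (u v : nat -> H) (x y l : H).

Lemma rcvgP u l : u @ \oo --> l <->
  (forall e : R, 0 < e -> \forall n \near \oo, rnorm (l - u n) < e).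
Proof.
rewrite cvgrPdist_lt; split=> ul e e0.
  have := ul e%:C; rewrite ltcR => /(_ e0).
  by apply: filterS => n; rewrite normE ltcR.
have eE : e = (complex.Re e)%:C by rewrite RRe_real // gtr0_real.
rewrite eE ltcR in e0; rewrite eE; apply: filterS (ul _ e0) => n.
by rewrite normE ltcR.
Qed.

Lemma rcvg_sandwich u l (f : nat -> R) : f @ \oo --> (0 : R) ->
  (forall n, rnorm (l - u n) <= f n) -> u @ \oo --> l.
Proof.
move=> f0 ulf; apply/rcvgP => e e0.
have /cvgrPdist_lt /(_ _ e0) := f0; apply: filterS => n.
by rewrite sub0r normrN => fe; apply: le_lt_trans (ulf n) (le_lt_trans (ler_norm _) fe).
Qed.

Lemma rcvg_norm u l : u @ \oo --> l -> (fun n => rnorm (l - u n)) @ \oo --> (0 : R).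
Proof.
move=> /rcvgP ul; apply/cvgrPdist_lt => e e0; apply: filterS (ul _ e0) => n.
by rewrite sub0r normrN ger0_norm // rnorm_ge0.
Qed.

Lemma rcvg_lin a u v x y : u @ \oo --> x -> v @ \oo --> y ->
  (fun n => a *: u n + v n) @ \oo --> a *: x + y.
Proof. by move=> ux vy; apply: cvgD => //; apply: cvgZl_tmp. Qed.

Lemma rcvg_uniq u x y : u @ \oo --> x -> u @ \oo --> y -> x = y.
Proof. by move=> ux uy; have := cvg_unique _ ux uy; apply. Qed.

(** A series dominated termwise by a bounded real series converges. *)
Lemma majorant_cvg u (s : nat -> R) C :
  (forall n, rnorm (u n.+1 - u n) <= s n.+1 - s n) -> (forall n, s n <= C) ->
  exists l, u @ \oo --> l.
Proof.
move=> us sC.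
have le_um n k : rnorm (u (n + k)%N - u n) <= s (n + k)%N - s n.
  elim: k => [|k IH]; first by rewrite addn0 !subrr rnorm0.
  rewrite addnS -(subrK (u (n + k)%N) (u _.+1)) -addrA.
  by apply: le_trans (rnormD _ _) _; have := us (n + k)%N; lra.
have s_nd : {homo s : n m / (n <= m)%N >-> n <= m}.
  by move=> n m /subnKC <-; rewrite -subr_ge0; apply: le_trans (rnorm_ge0 _) (le_um _ _).
have s_cvg : cvgn s.
  by apply: nondecreasing_is_cvgn => //; exists C => _ [n _ <-].
suff : cvg (u @ \oo) by move=> ul; exists (lim (u @ \oo)).
apply/cauchy_cvgP/cauchy_exP => e e0.
have eE : e = (complex.Re e)%:C by rewrite RRe_real // gtr0_real.
have er : 0 < complex.Re e by rewrite -ltcR -eE.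
have /cvgrPdist_lt /(_ _ er) [N _ sN] := s_cvg.
exists (u N), N => // n /= Nn.
rewrite -ball_normE /ball_ /= eE normE ltcR -rnormN opprB -(subnKC Nn).
apply: le_lt_trans (le_um _ _) _.
apply: le_lt_trans (sN N (leqnn N)); rewrite ger0_norm.
  by rewrite lerD2r nondecreasing_cvgn_le.
by rewrite subr_ge0 nondecreasing_cvgn_le.
Qed.

End Convergence.

Section Limits.
Variables (R : realType) (H : completeNormedModType R[i]).
Variable dot : {dot H for Num.conj}.
Hypothesis dot_norm : induces_norm dot.
Implicit Types (u v : nat -> H) (x y l : H).

Lemma rcvg_norm_le u l c :
  u @ \oo --> l -> (forall n, rnorm (u n) <= c) -> rnorm l <= c.
Proof.
move=> /rcvgP ul uc; apply/ler_addgt0Pl => e e0.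
have [n _ /(_ n (leqnn n)) un] := ul _ e0.
rewrite -(subrK (u n) l); apply: le_trans (rnormD _ _) _.
by rewrite lerD // ltW.
Qed.

Lemma rcvg_dot u l z :
  u @ \oo --> l -> (fun n => rdot dot (u n) z) @ \oo --> rdot dot l z.
Proof.
move=> /rcvgP ul; apply/cvgrPdist_lt => e e0.
have z0 : 0 < rnorm z + 1 by rewrite ltr_wpDl ?rnorm_ge0.
apply: filterS (ul _ (divr_gt0 e0 z0)) => n.
rewrite ltr_pdivlMr // -rdotNl -rdotDl => ulz.
apply: le_lt_trans (rdot_CS dot_norm _ _) (le_lt_trans _ ulz).
by rewrite ler_wpM2l ?rnorm_ge0 // lerDl.
Qed.

End Limits.

Section Linear.
Variables (R : realType) (H : completeNormedModType R[i]).
Variable dot : {dot H for Num.conj}.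
Hypothesis dot_norm : induces_norm dot.
Implicit Types (f g : H -> H) (x y : H) (a : R).

(** Linearity over the real numbers. *)
Definition rlinear f :=
  forall a x y, f (a%:C *: x + y) = a%:C *: f x + f y.

Lemma rlinear0 f : rlinear f -> f 0 = 0.
Proof.
move=> fl; have := fl 1 0 0; rewrite !scale1r addr0 => /esym/eqP.
by rewrite -subr_eq0 addrK => /eqP.
Qed.

Lemma rlinearD f x y : rlinear f -> f (x + y) = f x + f y.
Proof. by move=> fl; have := fl 1 x y; rewrite !scale1r. Qed.

Lemma rlinearZ f a x : rlinear f -> f (a%:C *: x) = a%:C *: f x.
Proof. by move=> fl; have := fl a x 0; rewrite (rlinear0 fl) !addr0. Qed.

Lemma rlinearN f x : rlinear f -> f (- x) = - f x.
Proof.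
by move=> fl; have := rlinearZ (-1) x fl; rewrite rmorphN /= !scaleN1r.
Qed.

Lemma rlinearB f x y : rlinear f -> f (x - y) = f x - f y.
Proof. by move=> fl; rewrite rlinearD // rlinearN. Qed.

(** An everywhere defined map that is its own adjoint. *)
Definition rsymmetric f := forall x y, rdot dot (f x) y = rdot dot x (f y).

(** A closed real linear subspace of the product of the space by itself, seen
    as a relation. *)
Record closed_rel (G : H -> H -> Prop) : Prop := ClosedRel {
  closed_rel0 : G 0 0;
  closed_rel_lin : forall a x y x' y', G x y -> G x' y' ->
    G (a%:C *: x + x') (a%:C *: y + y');
  closed_rel_lim : forall (u v : nat -> H) x y, (forall n, G (u n) (v n)) ->
    u @ \oo --> x -> v @ \oo --> y -> G x y
}.

Lemma closed_relZ G a x y : closed_rel G -> G x y -> G (a%:C *: x) (a%:C *: y).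
Proof.
case=> G0 Gl _ Gxy; rewrite -[_ *: x]addr0 -[_ *: y]addr0; exact: Gl.
Qed.

Lemma closed_relD G x y x' y' : closed_rel G -> G x y -> G x' y' ->
  G (x + x') (y + y').
Proof. by case=> _ Gl _ ? ?; have := Gl 1 x y x' y'; rewrite !scale1r; apply. Qed.

Lemma closed_relB G x y x' y' : closed_rel G -> G x y -> G x' y' ->
  G (x - x') (y - y').
Proof.
move=> cG Gxy /(closed_relZ (-1) cG); rewrite rmorphN /= !scaleN1r.
exact: closed_relD.
Qed.

(** * Neumann series and square roots *)

(** Inverse of [1 - r f] by the Neumann series. *)
Lemma neumann f r x : rlinear f -> (forall y, rnorm (f y) <= rnorm y) ->
  0 <= r < 1 -> exists y, y = x + r%:C *: f y.
Proof.
move=> fl f1 /andP[r0 r1].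
pose u := fix u n := if n is m.+1 then x + r%:C *: f (u m) else 0.
have du n : rnorm (u n.+1 - u n) <= r ^+ n * rnorm x.
  elim: n => [|n IH].
    by rewrite /= (rlinear0 fl) scaler0 addr0 subr0 mul1r.
  have -> : u n.+2 - u n.+1 = r%:C *: f (u n.+1 - u n).
    by rewrite rlinearB // scalerBr /= opprD addrACA subrr add0r.
  rewrite rnormZ ger0_norm // exprS -mulrA ler_wpM2l //.
  exact: le_trans (f1 _) IH.
pose s n := rnorm x * (1 - r ^+ n) / (1 - r).
have r1' : 0 < 1 - r by rewrite subr_gt0.
have [||l ul] := @majorant_cvg _ _ u s (rnorm x / (1 - r)).
- move=> n; apply: le_trans (du n) _; rewrite le_eqVlt; apply/orP; left.
  by apply/eqP; rewrite /s exprS; field; rewrite gt_eqF.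
- move=> n; rewrite /s ler_pM2r ?invr_gt0 // -[leRHS]mulr1.
  by rewrite ler_wpM2l ?rnorm_ge0 // gerBl exprn_ge0.
exists l.
have u1 : (fun n => u n.+1) @ \oo --> l by rewrite (cvg_shiftS u).
apply: rcvg_uniq u1 _.
apply: rcvg_sandwich (rcvg_norm ul) _ => n /=.
rewrite opprD addrACA subrr add0r -scalerBr -rlinearB // rnormZ ger0_norm //.
apply: le_trans (ler_wpM2l r0 (f1 _)) _.
by rewrite ler_piMl ?rnorm_ge0 // ltW.
Qed.

(** For a contraction [Z], the recursion [W_(n+1) = (Z + W_n ^ 2) / 2] converges
    because it is dominated by the scalar recursion
    [w_(n+1) = (1 + w_n ^ 2) / 2], which stays below [1]. The limit satisfies
    [(1 - W) ^ 2 = 1 - Z]. Since [W] is a limit of polynomials in [Z], it preserves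
    every closed relation that [Z] preserves; applied to graphs, this says that
    [W] commutes with every closed operator with which [Z] commutes. *)
Theorem sqrt_contraction (Z : H -> H) :
  rlinear Z -> (forall x, rnorm (Z x) <= rnorm x) ->
  exists W : H -> H,
  [/\ rlinear W,
      forall x, rnorm (W x) <= rnorm x,
      forall x, W x + W x = Z x + W (W x),
      rsymmetric Z -> rsymmetric W &
      forall G : H -> H -> Prop, closed_rel G ->
      (forall x y, G x y -> G (Z x) (Z y)) ->
      forall x y, G x y -> G (W x) (W y)].
Proof.
move=> Zl Z1.
pose F := fix F n x : H :=
  if n is m.+1 then (2^-1 : R)%:C *: (Z x + F m (F m x)) else 0.
pose w := fix w n : R := if n is m.+1 then (1 + w m ^+ 2) / 2 else 0.
have w01 n : 0 <= w n <= 1 by elim: n => [|n /andP[? ?]] /=; [lra | nra].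
have Fl n : rlinear (F n).
  elim: n => [|n IH] a x y; first by rewrite /= scaler0 addr0.
  rewrite /= Zl !IH [LHS]scalerDr [in RHS]scalerDr !scalerDr !scalerA.
  by rewrite ![(2^-1)%:C * _]mulrC addrACA.
have Fw n x : rnorm (F n x) <= w n * rnorm x.
  elim: n x => [|n IH] x; first by rewrite /= rnorm0 mul0r.
  rewrite /= rnormZ ger0_norm ?invr_ge0 //.
  have h1 := rnormD (Z x) (F n (F n x)); have h2 := Z1 x.
  have h3 := IH (F n x); have /andP[w0 _] := w01 n.
  have h4 := ler_wpM2l w0 (IH x); lra.
have dF n x : rnorm (F n.+1 x - F n x) <= (w n.+1 - w n) * rnorm x.
  elim: n x => [|n IH] x.
    rewrite /= addr0 subr0 rnormZ ger0_norm ?invr_ge0 //.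
    by have := Z1 x; lra.
  have -> : F n.+2 x - F n.+1 x = (2^-1 : R)%:C *:
      (F n.+1 (F n.+1 x - F n x) + (F n.+1 (F n x) - F n (F n x))).
    rewrite (rlinearB _ _ (Fl n.+1)) addrA subrK.
    rewrite [F n.+2 x]/= [F n.+1 x in X in _ - X = _]/= -scalerBr.
    by rewrite opprD addrACA subrr add0r.
  rewrite rnormZ ger0_norm ?invr_ge0 //.
  have h1 := rnormD (F n.+1 (F n.+1 x - F n x)) (F n.+1 (F n x) - F n (F n x)).
  have /andP[w0 _] := w01 n; have /andP[w0' _] := w01 n.+1.
  have d0 : 0 <= w n.+1 - w n by have := w01 n; rewrite /=; nra.
  have h2 := Fw n.+1 (F n.+1 x - F n x).
  have h3 := ler_wpM2l w0' (IH x).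
  have h4 := IH (F n x).
  have h5 := ler_wpM2l d0 (Fw n x).
  have -> : w n.+2 = (1 + w n.+1 ^+ 2) / 2 by [].
  have e : 2^-1 * (w n.+1 * ((w n.+1 - w n) * rnorm x) + (w n.+1 - w n) * (w n * rnorm x)) =
    ((1 + w n.+1 ^+ 2) / 2 - w n.+1) * rnorm x by rewrite [w n.+1]/=; field.
  rewrite -e; lra.
have cF x : exists l : H, (fun n => F n x) @ \oo --> l.
  apply: (@majorant_cvg _ _ _ (fun n => w n * rnorm x) (rnorm x)) => n.
    by rewrite -mulrBl.
  by rewrite ler_piMl ?rnorm_ge0 //; have /andP[] := w01 n.
have [W FW] := choice cF.
have F1 n x : rnorm (F n x) <= rnorm x.
  apply: le_trans (Fw n x) _; rewrite ler_piMl ?rnorm_ge0 //.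
  by have /andP[] := w01 n.
have FFW x : (fun n => F n (F n x)) @ \oo --> W (W x).
  have h : (fun n => rnorm (W x - F n x) + rnorm (W (W x) - F n (W x))) @ \oo --> (0 : R).
    by rewrite -[0](addr0 0); apply: cvgD; apply: rcvg_norm.
  apply: rcvg_sandwich h _ => n.
  have -> : W (W x) - F n (F n x) = W (W x) - F n (W x) + F n (W x - F n x).
    by rewrite rlinearB // addrA subrK.
  by rewrite addrC (le_trans (rnormD _ _)) // lerD2r.
have FS x : (fun n => F n.+1 x) @ \oo --> W x by rewrite (cvg_shiftS (F ^~ x)).
exists W; split.
- move=> a x y; apply: rcvg_uniq (FW _) _.
  have := rcvg_lin (a := a%:C) (FW x) (FW y); apply: cvg_trans; apply: near_eq_cvg.
  by apply: nearW => n; rewrite /= Fl.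
- by move=> x; apply: rcvg_norm_le (FW x) _.
- move=> x.
  have e : W x = (2^-1 : R)%:C *: (Z x + W (W x)).
    by apply: rcvg_uniq (FS x) _; apply: cvgZl_tmp; apply: cvgD => //; exact: cvg_cst.
  have half2 : 1 = (2^-1 : R)%:C + (2^-1 : R)%:C :> R[i].
    by rewrite -rmorphD /= -[LHS]/((1 : R)%:C); congr (_%:C); lra.
  by rewrite -[RHS]scale1r half2 scalerDl -e.
- move=> Zs x y; apply: cvg_unique (rcvg_dot dot_norm (FW x)) _ => //.
  have -> : (fun n => rdot dot (F n x) y) = (fun n => rdot dot (F n y) x).
    apply/funext => n; elim: n x y => [|n IH] x y; first by rewrite !rdotE.
    by rewrite /= !rdotE (Zs x y) (rdotC dot x) (IH (F n x)) (rdotC dot (F n y)) IH.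
  by rewrite (rdotC dot x); exact: (rcvg_dot dot_norm (FW y)).
- move=> G cG GZ x y Gxy; apply: closed_rel_lim (FW x) (FW y) => // n.
  elim: n x y Gxy => [|n IH] x y Gxy /=; first exact: closed_rel0.
  apply: closed_relZ => //; apply: closed_relD => //; first exact: GZ.
  exact: (IH _ _ (IH _ _ Gxy)).
Qed.

End Linear.

(** * Nearest points in closed subspaces *)

Section Projection.
Variables (R : realType) (H : completeNormedModType R[i]).
Variable dot : {dot H for Num.conj}.
Hypothesis dot_norm : induces_norm dot.
Local Notation "<< x , y >>" := (rdot dot x y).

(** The point [(x, y)] of a closed subspace of the product space that is nearest to
    [(w, 0)], characterized by orthogonality. *)
Lemma nearest_point (G : H -> H -> Prop) (w : H) : closed_rel G ->
  exists x y, G x y /\ forall a b, G a b -> << w - x, a >> = << y, b >>.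
Proof.
move=> cG.
pose phi a b := << w - a, w - a >> + << b, b >>.
have phi_ge0 a b : 0 <= phi a b.
  by rewrite /phi addr_ge0 ?(rdot_ge0 dot_norm).
pose E := [set t | exists a b, G a b /\ t = phi a b].
have hE : has_inf E.
  split; first by exists (phi 0 0), 0, 0; split=> //; exact: closed_rel0.
  by exists 0 => _ [a [b [_ ->]]].
set d := inf E.
have d_le a b : G a b -> d <= phi a b.
  by move=> Gab; apply: ge_inf; [case: hE | exists a, b].
have eps_gt0 n : 0 < (4^-1 : R) ^+ n by rewrite exprn_gt0 // invr_gt0.
have ab n : exists p : H * H, G p.1 p.2 /\ phi p.1 p.2 < d + 4^-1 ^+ n.
  have [_ [a [b [Gab ->]]] lt] := inf_adherent (eps_gt0 n) hE.
  by exists (a, b).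
have [p pP] := choice ab.
pose a n := (p n).1; pose b n := (p n).2.
have Gab n : G (a n) (b n) by case: (pP n).
have phi_lt n : phi (a n) (b n) < d + 4^-1 ^+ n by case: (pP n).
have half n : G ((2^-1 : R)%:C *: (a n.+1 + a n)) ((2^-1 : R)%:C *: (b n.+1 + b n)).
  by apply: closed_relZ => //; exact: closed_relD.
have sq4 n : (4^-1 : R) ^+ n = (2^-1 ^+ n) ^+ 2.
  by rewrite -exprM mulnC exprM expr2 -invfM -natrM.
(* parallelogram law, with the midpoint of two consecutive near-minimizers *)
have dab n : << a n.+1 - a n, a n.+1 - a n >> + << b n.+1 - b n, b n.+1 - b n >>
    <= (2 * 2^-1 ^+ n) ^+ 2.
  have := d_le _ _ (half n); have := phi_lt n; have := phi_lt n.+1.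
  rewrite /phi !rdotE (rdotC dot w (a n)) (rdotC dot w (a n.+1)) (rdotC dot (a n.+1) (a n))
    (rdotC dot (b n.+1) (b n)) !sq4.
  set h := 2^-1 ^+ n; have -> : 2^-1 ^+ n.+1 = h / 2 by rewrite exprS mulrC.
  rewrite !expr2; nra.
have p2 n : 0 <= 2 * 2^-1 ^+ n :> R by rewrite mulr_ge0 // exprn_ge0 // invr_ge0.
have sqge0 x : 0 <= << x, x >> := rdot_ge0 dot_norm x.
have da n : rnorm (a n.+1 - a n) <= 2 * 2^-1 ^+ n.
  by apply: (rnorm_sq_le dot_norm) => //; apply: le_trans (dab n); rewrite lerDl.
have db n : rnorm (b n.+1 - b n) <= 2 * 2^-1 ^+ n.
  by apply: (rnorm_sq_le dot_norm) => //; apply: le_trans (dab n); rewrite lerDr.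
have geo n : 2 * 2^-1 ^+ n <= (- (4 * 2^-1 ^+ n.+1)) - (- (4 * 2^-1 ^+ n)) :> R.
  by rewrite exprS; lra.
have geo0 n : - (4 * 2^-1 ^+ n) <= 0 :> R.
  by rewrite oppr_le0 mulr_ge0 // exprn_ge0 // invr_ge0.
have [x ax] := majorant_cvg (fun n => le_trans (da n) (geo n)) geo0.
have [y bx] := majorant_cvg (fun n => le_trans (db n) (geo n)) geo0.
exists x, y; split; first exact: closed_rel_lim Gab ax bx.
move=> a' b' Gab'.
pose e n := << w - a n, a' >> - << b n, b' >>.
pose N := << a', a' >> + << b', b' >>.
(* near-orthogonality: compare with the points displaced by [t (a', b')],
   for [t = 2^-n] and [t = - 2^-n] *)
have eN n : `|e n| <= 2^-1 ^+ n * (1 + N).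
  have h t : d <= phi (a n) (b n) - 2 * t * e n + t ^+ 2 * N.
    have := d_le _ _ (closed_rel_lin cG t Gab' (Gab n)).
    rewrite /phi /e /N !rdotE (rdotC dot w (a n)) (rdotC dot w a') (rdotC dot (a n) a')
      (rdotC dot (b n) b').
    by congr (_ <= _); ring.
  have := phi_lt n; rewrite sq4; set k := 2^-1 ^+ n => hk.
  have k0 : 0 < k by rewrite exprn_gt0 // invr_gt0.
  have N0 : 0 <= N by rewrite addr_ge0.
  have h1 := h k; have h2 := h (- k).
  have : 2 * k * `|e n| <= k ^+ 2 * (1 + N).
    by case: (ger0P (e n)) => _; lra.
  move=> hke; rewrite -(ler_pM2l k0).
  by have := mulr_ge0 (ltW k0) (normr_ge0 (e n)); rewrite expr2 in hke; lra.
have e0 : e @ \oo --> (0 : R).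
  have g0 : geometric (1 + N) (2^-1 : R) @ \oo --> (0 : R).
    by apply: cvg_geometric; rewrite ger0_norm ?invr_ge0 // invf_lt1 // ltr1n.
  apply/cvgrPdist_lt => r r0; have /cvgrPdist_lt /(_ _ r0) := g0.
  apply: filterS => n; rewrite !sub0r !normrN /=; apply: le_lt_trans.
  by rewrite (le_trans (eN n)) // mulrC ler_norm.
have e1 : e @ \oo --> << w - x, a' >> - << y, b' >>.
  apply: cvgB; last exact: (rcvg_dot dot_norm).
  by apply: (rcvg_dot dot_norm); apply: cvgB => //; exact: cvg_cst.
by apply/eqP; rewrite -subr_eq0; apply/eqP; have := cvg_unique _ e1 e0; apply.
Qed.

End Projection.

(** * Positive and negative parts *)

Section SpectralSplitting.
Variables (R : realType) (H : completeNormedModType R[i]).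
Variable dot : {dot H for Num.conj}.
Hypothesis dot_norm : induces_norm dot.
Local Notation "<< x , y >>" := (rdot dot x y).
Implicit Types (x y z : H) (e : R).

(** [U] and [V] behave as the negative and the positive part of [Q - e]. Instead of
    the positivity of [U] and [V], only that of [V] on [ker U] and of [U] on [ker V]
    is recorded. The last clause holds because [Q >= e > 0] on [ker U]. *)
Record splitting (Q : H -> H) e (U V : H -> H) : Prop := Splitting {
  split_linU : rlinear U;
  split_bndU : forall x, rnorm (U x) <= 3 * rnorm x;
  split_comm : forall G : H -> H -> Prop, closed_rel G ->
    (forall x y, G x y -> G (Q x) (Q y)) ->
    forall x y, G x y -> G (U x) (U y) /\ G (V x) (V y);
  split_UV : forall x, U (V x) = 0;
  split_VU : forall x, V (U x) = 0;
  split_symV : rsymmetric dot V;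
  split_diff : forall x, Q x = e%:C *: x + V x - U x;
  split_posV : forall x, U x = 0 -> 0 <= << V x, x >>;
  split_posU : forall x, V x = 0 -> 0 <= << U x, x >>;
  split_range : forall x, U x = 0 -> exists y, Q y = x
}.

Lemma closed_rel_graph (f : H -> H) C : rlinear f ->
  (forall x, rnorm (f x) <= C * rnorm x) -> closed_rel (fun x y => y = f x).
Proof.
move=> fl fC; split; first by rewrite rlinear0.
  by move=> a x y x' y' -> ->; rewrite fl.
move=> u v x y uv ux vy; apply: rcvg_uniq vy _.
have h : (fun n => C * rnorm (x - u n)) @ \oo --> (0 : R).
  by rewrite -(mulr0 C); apply: cvgMr; exact: rcvg_norm.
by apply: rcvg_sandwich h _ => n /=; rewrite uv -rlinearB.
Qed.

Lemma splitting_exists (Q : H -> H) e : rlinear Q ->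
  (forall x, rnorm (Q x) <= rnorm x) -> rsymmetric dot Q -> 0 < e < 1 ->
  exists U V, splitting Q e U V.
Proof.
move=> Ql Q1 Qs /andP[e0 e1].
(* half of [Q - e], which is a contraction *)
pose K x := (2^-1 : R)%:C *: Q x + (- (e / 2))%:C *: x.
have KE x : K x = (2^-1 : R)%:C *: Q x + (- (e / 2))%:C *: x by [].
clearbody K.
have Kl : rlinear K.
  move=> a x y; apply: (rdot_ext dot_norm) => z.
  by rewrite !KE Ql !rdotE; ring.
have K1 x : rnorm (K x) <= rnorm x.
  rewrite KE; apply: le_trans (rnormD _ _) _; rewrite !rnormZ normrN !ger0_norm; try lra.
  by have := Q1 x; have := rnorm_ge0 x; nra.
have Ks : rsymmetric dot K by move=> x y; rewrite !KE !rdotE Qs.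
(* [K ^ 2 = 1 - Z], so that [P = 1 - W] below is the absolute value of [K] *)
pose Z x := x - K (K x).
have ZE x : Z x = x - K (K x) by [].
clearbody Z.
have Zl : rlinear Z.
  by move=> a x y; apply: (rdot_ext dot_norm) => z; rewrite !ZE !Kl !rdotE; ring.
have Zs : rsymmetric dot Z.
  by move=> x y; rewrite !ZE !rdotE !Ks.
have Z1 x : rnorm (Z x) <= rnorm x.
  apply: (rnorm_sq_le dot_norm); first exact: rnorm_ge0.
  have e2 : << K (K x), x >> = << K x, K x >> by rewrite Ks.
  rewrite !ZE !rdotE (rdotC dot x (K (K x))) e2 !rdotxx //.
  have := K1 (K x); have := rnorm_ge0 (K (K x)); nra.
have [W [Wl W1 W2 Ws WG]] := sqrt_contraction dot_norm Zl Z1.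
have {}Ws := Ws Zs.
pose P x := x - W x.
have PE x : P x = x - W x by [].
clearbody P.
have Pl : rlinear P.
  by move=> a x y; apply: (rdot_ext dot_norm) => z; rewrite !PE !Wl !rdotE; ring.
have Ps : rsymmetric dot P by move=> x y; rewrite !PE !rdotE Ws.
have PP x : P (P x) = K (K x).
  rewrite !PE rlinearB //; apply: (rdot_ext dot_norm) => z.
  have : rdot dot (W x + W x) z = rdot dot (Z x + W (W x)) z by rewrite W2.
  by rewrite !ZE !rdotE; lra.
have P_ge0 x : 0 <= << P x, x >>.
  rewrite !PE !rdotE rdotxx //.
  have := rdot_CS dot_norm (W x) x; have := W1 x; have := rnorm_ge0 x.
  have := ler_norm (<< W x, x >>); nra.
have KG G : closed_rel G -> (forall x y, G x y -> G (Q x) (Q y)) ->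
    forall x y, G x y -> G (K x) (K y).
  move=> cG GQ x y xy; rewrite !KE; apply: closed_relD => //; apply: closed_relZ => //.
  exact: GQ.
have PG G : closed_rel G -> (forall x y, G x y -> G (Q x) (Q y)) ->
    forall x y, G x y -> G (P x) (P y).
  move=> cG GQ x y xy; rewrite !PE; apply: closed_relB => //.
  apply: WG xy => // a b ab; rewrite !ZE; apply: closed_relB => //.
  exact: (KG _ cG GQ _ _ (KG _ cG GQ _ _ ab)).
have PK x : P (K x) = K (P x).
  have cK : closed_rel (fun x y => y = K x).
    by apply: (@closed_rel_graph K 1) => // y; rewrite mul1r.
  apply: (PG _ cK) => // a b ->.
  by rewrite !KE !(rlinearD _ _ Ql) !(rlinearZ _ _ Ql).
exists (fun x => P x - K x), (fun x => P x + K x); split.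
- by move=> a x y; apply: (rdot_ext dot_norm) => z; rewrite Pl Kl !rdotE; ring.
- move=> x; have := rnormB (P x) (K x); have := rnormB x (W x).
  by have := K1 x; have := W1 x; rewrite -(PE x); lra.
- move=> G cG GQ x y xy.
  have hP := PG _ cG GQ _ _ xy; have hK := KG _ cG GQ _ _ xy.
  by split; [exact: closed_relB | exact: closed_relD].
- move=> x; rewrite (rlinearD _ _ Pl) (rlinearD _ _ Kl) PP PK.
  by apply: (rdot_ext dot_norm) => z; rewrite !rdotE; ring.
- move=> x; rewrite (rlinearB _ _ Pl) (rlinearB _ _ Kl) PP PK.
  by apply: (rdot_ext dot_norm) => z; rewrite !rdotE; ring.
- by move=> x y; rewrite !rdotE Ps Ks.
- move=> x; apply: (rdot_ext dot_norm) => z; rewrite !KE !rdotE; lra.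
- by move=> x /= /subr0_eq <-; rewrite rdotDl; apply: addr_ge0; exact: P_ge0.
- by move=> x /= /addr0_eq <-; rewrite opprK rdotDl; apply: addr_ge0; exact: P_ge0.
- move=> x /= /subr0_eq Ux.
  (* On [ker U], [Q = e + 2 K = e + 2 P], and [e + 2 P = (2 + e) - 2 W] is
     invertible. *)
  have r01 : 0 <= 2 / (2 + e) < 1.
    by rewrite divr_ge0 ?ltr_pdivrMr //=; lra.
  have [y yE] := neumann (((2 + e)^-1)%:C *: x) Wl W1 r01.
  have yx : e%:C *: y + P y + P y = x.
    apply: (rdot_ext dot_norm) => z; rewrite !PE.
    have : << y, z >> = << ((2 + e)^-1)%:C *: x + (2 / (2 + e))%:C *: W y, z >> by rewrite -yE.
    rewrite !rdotE => h.
    have -> : << x, z >> = (2 + e) * << y, z >> - 2 * << W y, z >> by rewrite h; field; lra.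
    by ring.
  (* The solution [y] is again in [ker U], since [(e + 2 P) (U y) = U x = 0]. *)
  pose d := P y - K y.
  have dE : d = P y - K y by [].
  clearbody d.
  have d0 : d = 0.
    apply/rnorm_eq0.
    have : e%:C *: d + P d + P d = 0.
      transitivity (P x - K x); last by rewrite Ux subrr.
      rewrite -yx dE !(rlinearD _ _ Pl) !(rlinearD _ _ Kl) (rlinearZ _ _ Pl).
      rewrite (rlinearZ _ _ Kl) !(rlinearN _ Pl) PK.
      by apply: (rdot_ext dot_norm) => z; rewrite !rdotE; ring.
    move=> /(congr1 (fun v => << v, d >>)); rewrite !rdotE rdotxx // => h.
    by apply/eqP; rewrite -sqrf_eq0; apply/eqP; have := P_ge0 d; have := sqr_ge0 (rnorm d); nra.
  exists y; rewrite -{}yx; move: d0; rewrite dE => /subr0_eq ->.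
  by apply: (rdot_ext dot_norm) => z; rewrite !KE !rdotE; lra.
Qed.

End SpectralSplitting.

(** * Adjoints and the resolvent [(1 + A^* A)^-1] *)

Section Adjoints.
Variables (R : realType) (H : completeNormedModType R[i]).
Variable dot : {dot H for Num.conj}.
Hypothesis dot_norm : induces_norm dot.
Local Notation "<< x , y >>" := (rdot dot x y).
Implicit Types (x y z : H) (S A : operator H).

(** The graph of a partially defined operator, as a relation. *)
Definition operator_rel S x y := dom S x /\ y = S x.

Lemma dense_approx S v (e : R) : densely_defined S -> 0 < e ->
  exists w, dom S w /\ rnorm (v - w) < e.
Proof.
move=> dS e0.
have eC : 0 < e%:C by rewrite ltcR.
have [w [vw Sw]] : ball v e%:C `&` dom S !=set0.
  apply: dS; first by exists v; exact: ballxx.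
  exact: ball_open.
exists w; split => //.
by move: vw; rewrite -ball_normE /ball_ /= normE ltcR.
Qed.

(** The imaginary part of the adjoint relation at [x] is, up to sign, its real part at
    [i x]. *)
Lemma real_adjoint_value S y z : linear_operator S ->
  (forall x, dom S x -> << S x, y >> = << x, z >>) -> is_adjoint_value dot S y z.
Proof.
move=> [S0 Sl SE] Syz x Sx.
have Six : dom S ('i%C *: x) by rewrite -[_ *: _]addr0; apply: Sl.
have S00 : S 0 = 0.
  by have := SE 1 0 0 S0 S0; rewrite !scale1r addr0 => /eqP; rewrite eq_sym -subr_eq0 addrK => /eqP.
have Si : S ('i%C *: x) = 'i%C *: S x.
  by rewrite -[in LHS](addr0 ('i%C *: x)) SE // S00 addr0.
have := Syz _ Six; rewrite Si /rdot !linearZl_LR /=.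
have := Syz _ Sx; rewrite /rdot.
case: (dot (S x) y) => a b; case: (dot x z) => c d /= -> /eqP.
by rewrite !mul0r !sub0r !mul1r eqr_opp => /eqP ->.
Qed.

Lemma adjoint_char S y z : linear_operator S -> densely_defined S ->
  (forall x, dom S x -> << S x, y >> = << x, z >>) ->
  dom (adjoint dot S) y /\ adjoint dot S y = z.
Proof.
move=> Sl dS Syz; have Sv := real_adjoint_value Sl Syz.
have Sy : dom (adjoint dot S) y by exists z.
split=> //.
exact: adjoint_unique dot_norm dS (adjointP Sy) Sv.
Qed.

Lemma rdot_adjoint S x y : dom S x -> dom (adjoint dot S) y ->
  << S x, y >> = << x, adjoint dot S y >>.
Proof. by move=> Sx Sy; rewrite /rdot (adjointP Sy). Qed.

Lemma closed_rel_adjoint S : linear_operator S -> densely_defined S ->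
  closed_rel (operator_rel (adjoint dot S)).
Proof.
move=> Sl dS.
have mk x y : (forall v, dom S v -> << S v, x >> = << v, y >>) ->
    operator_rel (adjoint dot S) x y.
  by move=> h; have [? <-] := adjoint_char Sl dS h.
split.
- by apply: mk => v _; rewrite !rdotE.
- move=> a x y x' y' [Sx ->] [Sx' ->]; apply: mk => v Sv.
  by rewrite !rdotE !rdot_adjoint.
- move=> u v x y uv ux vy; apply: mk => w Sw.
  have h1 := rcvg_dot dot_norm (z := S w) ux; have h2 := rcvg_dot dot_norm (z := w) vy.
  rewrite rdotC (rdotC dot w); apply: cvg_unique h1 _ => //.
  have -> // : (fun n => rdot dot (u n) (S w)) = (fun n => rdot dot (v n) w).
  by apply/funext => n; have [Su ->] := uv n; rewrite rdotC rdot_adjoint // rdotC.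
Qed.

Lemma closed_rel_operator S : linear_operator S -> closed_operator S ->
  closed_rel (operator_rel S).
Proof.
move=> [S0 Sl SE] Sc; split.
- have := SE 1 0 0 S0 S0; rewrite !scale1r addr0 => /eqP.
  by rewrite eq_sym -subr_eq0 addrK => /eqP Sz; split.
- by move=> a x y x' y' [Sx ->] [Sx' ->]; split; [apply: Sl | rewrite SE].
- move=> u v x y uv ux vy.
  have : graph S (x, y); last by [].
  apply: (closed_cvg (graph S) Sc (F := \oo) (u_ := fun n => (u n, v n))).
    by apply: nearW => n; have [] := uv n.
  exact: cvg_pair.
Qed.

(** The point of the graph of [A] nearest to [(w, 0)] is [(x, A x)] with
    [x + A^* (A x) = w]. *)
Lemma resolvent_exists A : linear_operator A -> densely_defined A ->
  closed_operator A -> exists Q : H -> H, forall w,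
  [/\ dom A (Q w), dom (adjoint dot A) (A (Q w)) &
      adjoint dot A (A (Q w)) = w - Q w].
Proof.
move=> Al dA cA.
have : forall w, exists x, [/\ dom A x, dom (adjoint dot A) (A x) &
      adjoint dot A (A x) = w - x].
  move=> w.
  have [x [_ [[Ax ->] h]]] := nearest_point dot_norm w (closed_rel_operator Al cA).
  exists x; have [|? ->] := @adjoint_char A (A x) (w - x) Al dA; last by split.
  by move=> a Aa; rewrite rdotC -(h a) 1?rdotC.
by move=> /choice [Q QP]; exists Q.
Qed.

(** A closed operator [S] that commutes with [Q] and for which
    [Q = (1 + S^* S)^-1] holds in the sense of quadratic forms. For [A] normal and
    [Q = (1 + A^* A)^-1], both [A] and its adjoint have this property. *)
Record compatible (Q : H -> H) S : Prop := Compatible {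
  compat_closed : closed_rel (operator_rel S);
  compat_dom : forall x, dom S (Q x);
  compat_comm : forall x, dom S x -> S (Q x) = Q (S x);
  compat_form : forall x, dom S x ->
    << x, Q x >> + << S x, Q (S x) >> = << x, x >>
}.

Section Normal.
Variables (A : operator H) (Q : H -> H).
Hypotheses (Al : linear_operator A) (An : normal_operator dot A).
Hypothesis QP : forall w,
  [/\ dom A (Q w), dom (adjoint dot A) (A (Q w)) &
      adjoint dot A (A (Q w)) = w - Q w].
Local Notation A' := (adjoint dot A).

Let dA : densely_defined A. Proof. by case: An. Qed.
Let cA : closed_rel (operator_rel A).
Proof. by case: An => _ ? _; exact: closed_rel_operator. Qed.
Let cA' : closed_rel (operator_rel A'). Proof. exact: closed_rel_adjoint. Qed.

Lemma normal_dom x : dom A x /\ dom A' (A x) <-> dom A' x /\ dom A (A' x).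
Proof. by case: An => _ _ [/= /(congr1 (@^~ x)) /= ->]. Qed.

Lemma normal_comm x : dom A x -> dom A' (A x) -> A (A' x) = A' (A x).
Proof. by case: An => _ _ [/= _ e] Ax A'x; apply: e; apply/normal_dom. Qed.

Lemma resolvent_unique x w : dom A x -> dom A' (A x) -> A' (A x) = w - x -> x = Q w.
Proof.
move=> Ax A'x e; have [AQ A'Q eQ] := QP w.
have [Ad AdE] := closed_relB cA (conj Ax erefl) (conj AQ erefl).
have [A'd A'dE] := closed_relB cA' (conj A'x erefl) (conj A'Q erefl).
rewrite AdE in A'd A'dE; rewrite e eQ in A'dE.
set d := x - Q w in Ad AdE A'd A'dE.
apply/subr0_eq; rewrite -/d; apply/rnorm_eq0.
have := rdot_adjoint Ad A'd; rewrite -A'dE.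
have -> : w - x - (w - Q w) = - d.
  by apply: (rdot_ext dot_norm) => z; rewrite /d !rdotE; ring.
rewrite rdotNr !rdotxx // => h.
have := sqr_ge0 (rnorm (A d)); have := sqr_ge0 (rnorm d) => h1 h2.
by apply/eqP; rewrite -sqrf_eq0 eq_le h1 andbT; lra.
Qed.

Lemma resolvent_linear : rlinear Q.
Proof.
move=> a x y; apply/esym; have [AQ A'Q eQ] := QP x; have [AQ' A'Q' eQ'] := QP y.
have [Ad AdE] := closed_rel_lin cA a (conj AQ erefl) (conj AQ' erefl).
have [A'd A'dE] := closed_rel_lin cA' a (conj A'Q erefl) (conj A'Q' erefl).
rewrite AdE in A'd A'dE.
apply: resolvent_unique => //; rewrite -A'dE eQ eQ'.
by apply: (rdot_ext dot_norm) => z; rewrite !rdotE; ring.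
Qed.

Lemma resolvent_form x y : << Q x, y >> = << Q x, Q y >> + << A (Q x), A (Q y) >>.
Proof.
have [AQ _ _] := QP x; have [AQ' A'Q' eQ'] := QP y.
by rewrite rdot_adjoint // eQ' !rdotE; ring.
Qed.

Lemma resolvent_symmetric : rsymmetric dot Q.
Proof.
move=> x y; rewrite (rdotC dot x) (resolvent_form x y) (resolvent_form y x) (rdotC dot (Q y)).
by rewrite (rdotC dot (A (Q y))).
Qed.

Lemma resolvent_contraction x : rnorm (Q x) <= rnorm x.
Proof.
have := resolvent_form x x; rewrite !rdotxx // => e.
have := rdot_CS dot_norm (Q x) x; have := ler_norm << Q x, x >>.
have := sqr_ge0 (rnorm (A (Q x))); have := rnorm_ge0 (Q x); have := rnorm_ge0 x.
rewrite e !expr2; nra.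
Qed.

Lemma compatible_normal : compatible Q A.
Proof.
have comm x : dom A x -> A (Q x) = Q (A x).
  move=> Ax; have [AQ A'Q eQ] := QP x.
  have [Ad AdE] := closed_relB cA (conj Ax erefl) (conj AQ erefl).
  rewrite -eQ in Ad AdE.
  have [AAQ A'AQ] := (normal_dom (A (Q x))).2 (conj A'Q Ad).
  by apply: resolvent_unique => //; rewrite -normal_comm.
split=> // [x|x Ax]; have [AQ A'Q eQ] := QP x => //.
by rewrite -comm // rdot_adjoint // eQ !rdotE; ring.
Qed.

Lemma compatible_adjoint : compatible Q A'.
Proof.
have QP' w : [/\ dom A' (Q w), dom A (A' (Q w)) & A (A' (Q w)) = w - Q w].
  have [AQ A'Q eQ] := QP w.
  have [? ?] := (normal_dom (Q w)).1 (conj AQ A'Q).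
  by split=> //; rewrite normal_comm.
have comm x : dom A' x -> A' (Q x) = Q (A' x).
  move=> A'x; have [AQ A'Q eQ] := QP' x.
  have [Ad AdE] := closed_relB cA' (conj A'x erefl) (conj AQ erefl).
  rewrite -eQ in Ad AdE.
  by apply: resolvent_unique.
split=> // [x|x A'x]; have [AQ A'Q eQ] := QP' x => //.
by rewrite -comm // [<< A' x, _ >>]rdotC -rdot_adjoint // eQ rdotC !rdotE; ring.
Qed.

End Normal.
End Adjoints.

(** * Spectral subspaces *)

Section SpectralSubspaces.
Variables (R : realType) (H : completeNormedModType R[i]).
Variable dot : {dot H for Num.conj}.
Hypothesis dot_norm : induces_norm dot.
Local Notation "<< x , y >>" := (rdot dot x y).
Implicit Types (x y z : H) (S : operator H) (e : R).
Variable Q : H -> H.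
Hypotheses (Ql : rlinear Q) (Q1 : forall x, rnorm (Q x) <= rnorm x).

Section OneLevel.
Variables (S : operator H) (e : R) (U V : H -> H).
Hypotheses (cS : compatible dot Q S) (sp : splitting dot Q e U V).

Lemma split_comm_compat x : dom S x ->
  [/\ dom S (U x), S (U x) = U (S x), dom S (V x) & S (V x) = V (S x)].
Proof.
move=> Sx; have [|[SU ->] [SV ->]] :=
  split_comm sp (compat_closed cS) _ (conj Sx erefl); last by [].
move=> a b [Sa ->]; split; [exact: compat_dom cS a | by rewrite (compat_comm cS)].
Qed.

Lemma kerU_stable x : dom S x -> U x = 0 -> U (S x) = 0.
Proof.
move=> Sx Ux; have [_ <- _ _] := split_comm_compat Sx; rewrite Ux.
by have [_ <-] := closed_rel0 (compat_closed cS).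
Qed.

Lemma kerV_stable x : dom S x -> V x = 0 -> V (S x) = 0.
Proof.
move=> Sx Vx; have [_ _ _ <-] := split_comm_compat Sx; rewrite Vx.
by have [_ <-] := closed_rel0 (compat_closed cS).
Qed.

Lemma kerU_dom x : U x = 0 -> dom S x.
Proof. by move=> /(split_range sp)[y <-]; exact: compat_dom cS y. Qed.

(** On [ker U], the operator [Q - e] is nonnegative; the inequality is the sum of
    this at [x] and at [S x]. *)
Lemma kerU_bound x : U x = 0 ->
  e * (<< x, x >> + << S x, S x >>) <= << x, x >>.
Proof.
move=> Ux; have Sx := kerU_dom Ux; have USx := kerU_stable Sx Ux.
have := compat_form cS Sx; rewrite !(split_diff sp) Ux USx !subr0 !rdotDr !rdotZr.
have := split_posV sp Ux; have := split_posV sp USx.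
by rewrite (rdotC dot (V x)) (rdotC dot (V (S x))); lra.
Qed.

(** On [ker V], the operator [Q - e] is nonpositive. *)
Lemma kerV_bound x : dom S x -> V x = 0 ->
  << x, x >> <= e * (<< x, x >> + << S x, S x >>).
Proof.
move=> Sx Vx; have VSx := kerV_stable Sx Vx.
have := compat_form cS Sx; rewrite !(split_diff sp) Vx VSx !addr0 !rdotDr !rdotNr !rdotZr.
have := split_posU sp Vx; have := split_posU sp VSx.
by rewrite (rdotC dot (U x)) (rdotC dot (U (S x))); lra.
Qed.

End OneLevel.

Lemma split_comm_map e U V (f : H -> H) C : splitting dot Q e U V ->
  rlinear f -> (forall x, rnorm (f x) <= C * rnorm x) ->
  (forall x, f (Q x) = Q (f x)) -> forall x, f (U x) = U (f x) /\ f (V x) = V (f x).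
Proof.
move=> sp fl fC fQ x.
have [|-> ->] := split_comm sp (closed_rel_graph fl fC) _ (erefl (f x)); last by [].
by move=> a b ->; rewrite fQ.
Qed.

Section TwoLevels.
Variables (e e' : R) (U V U' V' : H -> H).
Hypotheses (e'0 : 0 < e') (ee' : e' < e) (e1 : e < 1).
Hypotheses (sp : splitting dot Q e U V) (sp' : splitting dot Q e' U' V').

(** The component [U' x] of [x] would satisfy the inequalities of [kerU_bound] at
    level [e] and of [kerV_bound] at level [e'], which exclude each other unless
    it is [0]. *)
Lemma kerU_nested S x : compatible dot Q S -> U x = 0 -> U' x = 0.
Proof.
move=> cS Ux; apply: (rdot_le0 dot_norm); set z := U' x.
have QU y : U' (Q y) = Q (U' y).
  have Qb w : rnorm (Q w) <= 1 * rnorm w by rewrite mul1r.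
  by have [<- _] := split_comm_map sp' Ql Qb (fun=> erefl) y.
have Uz : U z = 0.
  have [<- _] := split_comm_map sp (split_linU sp') (split_bndU sp') QU x.
  by rewrite Ux rlinear0 //; exact: split_linU sp'.
have V'z : V' z = 0 by exact: split_VU sp' x.
have h1 := kerU_bound cS sp Uz.
have h2 := kerV_bound cS sp' (kerU_dom cS sp Uz) V'z.
rewrite leNgt; apply/negP => z0; have Sz0 := rdot_ge0 dot_norm (S z).
have : 0 < (e - e') * (<< z, z >> + << S z, S z >>) by rewrite mulr_gt0 ?subr_gt0 ?ltr_wpDr.
by lra.
Qed.

(** A bounded operator [B] that intertwines [A'] and [A] maps [ker U], at level [e],
    into [ker U'], at the lower level [e']. Indeed [U' (B x)] is in [ker V'], so the
    square of its norm grows under powers of [A] at least at the rate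
    [(1 - e') / e'], whereas that of [x] grows under powers of [A'] at most at
    the smaller rate [(1 - e) / e]. *)
Lemma kerU_intertwine A A' (B : H -> H) M x :
  compatible dot Q A -> compatible dot Q A' ->
  (forall y, rnorm (B y) <= M * rnorm y) ->
  (forall y, dom A' y -> dom A (B y) /\ A (B y) = B (A' y)) ->
  U x = 0 -> U' (B x) = 0.
Proof.
move=> cA cA' BM BA Ux; apply: (rdot_le0 dot_norm).
pose u k := iter k A' x; pose z k := U' (B (u k)).
have Uu k : U (u k) = 0.
  elim: k => [//|k IH]; rewrite /u iterS.
  by apply: (kerU_stable cA' sp) => //; exact: (kerU_dom cA' sp).
have Au k : dom A' (u k) := kerU_dom cA' sp (Uu k).
have zA k : dom A (z k) /\ A (z k) = z k.+1.
  have [ABu ABuE] := BA _ (Au k).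
  by have [? + _ _] := split_comm_compat cA sp' ABu; rewrite ABuE.
have V'z k : V' (z k) = 0 by exact: split_VU sp' _.
have e0 : 0 < e := lt_trans e'0 ee'.
pose r := (1 - e) / e; pose a := (1 - e') / e'.
have r0 : 0 <= r by rewrite divr_ge0 ?subr_ge0 // ltW.
have a0 : 0 < a by rewrite divr_gt0 ?subr_gt0 // (lt_trans ee').
have ra : r < a by rewrite /r /a ltr_pdivrMr // mulrAC ltr_pdivlMr //; move: ee'; lra.
have ub k : << u k, u k >> <= r ^+ k * << x, x >>.
  elim: k => [|k IH]; first by rewrite mul1r.
  have h := kerU_bound cA' sp (Uu k).
  have -> : u k.+1 = A' (u k) by [].
  rewrite exprS -mulrA; apply: le_trans (ler_wpM2l r0 IH).
  by rewrite /r mulrAC ler_pdivlMr //; lra.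
have lb k : a ^+ k * << z 0%N, z 0%N >> <= << z k, z k >>.
  elim: k => [|k IH]; first by rewrite mul1r.
  have [Az AzE] := zA k.
  have h := kerV_bound cA sp' Az (V'z k); rewrite AzE in h.
  rewrite exprS -mulrA; apply: le_trans (ler_wpM2l (ltW a0) IH) _.
  by rewrite /a mulrAC ler_pdivrMr //; lra.
pose C := (3 * M) ^+ 2.
have zu k : << z k, z k >> <= C * << u k, u k >>.
  rewrite !rdotxx // -exprMn ler_pXn2r ?nnegrE ?rnorm_ge0 //.
    rewrite -mulrA; apply: le_trans (split_bndU sp' _) _.
    by rewrite ler_pM2l.
  by rewrite -mulrA mulr_ge0 //; apply: le_trans (BM _); exact: rnorm_ge0.
have bound k : << z 0%N, z 0%N >> <= C * << x, x >> * (r / a) ^+ k.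
  have ak : 0 < a ^+ k by rewrite exprn_gt0.
  rewrite expr_div_n mulrA ler_pdivlMr // mulrC -mulrA [_ * r ^+ k]mulrC.
  apply: le_trans (lb k) (le_trans (zu k) _).
  by rewrite ler_wpM2l // sqr_ge0.
have g0 : geometric (C * << x, x >>) (r / a) @ \oo --> (0 : R).
  have ra0 : 0 <= r / a by rewrite divr_ge0 // ltW.
  by apply: cvg_geometric; rewrite ger0_norm // ltr_pdivrMr // mul1r.
rewrite leNgt; apply/negP => z0.
have /cvgrPdist_lt /(_ _ z0) [n _ /(_ n (leqnn n))] := g0.
rewrite sub0r normrN /= => /(le_lt_trans (ler_norm _)).
by rewrite ltNge bound.
Qed.

End TwoLevels.
End SpectralSubspaces.

(** * Reducing subspaces *)

Section ReducingSubspaces.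
Variables (R : realType) (H : completeNormedModType R[i]).
Variable dot : {dot H for Num.conj}.
Hypothesis dot_norm : induces_norm dot.
Local Notation "<< x , y >>" := (rdot dot x y).
Implicit Types (x y z : H) (e : R).

Lemma pythagoras_le p q w : w = p + q -> << q, p >> = 0 -> << q, q >> <= << w, w >>.
Proof.
move=> -> qp; rewrite !rdotE (rdotC dot p) qp addr0 add0r lerDr.
exact: rdot_ge0.
Qed.

Variables (A : operator H) (Q : H -> H) (U V : R -> H -> H).
Local Notation A' := (adjoint dot A).
Hypotheses (dA : densely_defined A).
Hypotheses (Ql : rlinear Q) (Q1 : forall x, rnorm (Q x) <= rnorm x).
Hypotheses (cA : compatible dot Q A) (cA' : compatible dot Q A').
Hypothesis sp : forall e, 0 < e < 1 -> splitting dot Q e (U e) (V e).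

(** The subspace [L_e]: the intersection of the kernels of the negative parts of
    [Q - e'] over [0 < e' < e]. In terms of spectral measures, the range of the
    spectral projection of [Q] on [[e, 1]]. *)
Definition level e x := forall e', 0 < e' < e -> U e' x = 0.

Section Level.
Variable e : R.
Hypothesis e01 : 0 < e < 1.

Let lt_e e' : 0 < e' < e -> 0 < e' < 1.
Proof. by move=> /andP[-> /lt_trans->] //; have /andP[] := e01. Qed.

Let half_e : 0 < e / 2 < e.
Proof. by move: e01; lra. Qed.

Lemma kerU_level x : U e x = 0 -> level e x.
Proof.
move=> Ux e' e'e; have /andP[e'0 ee'] := e'e.
exact: kerU_nested ee' (sp e01) (sp (lt_e e'e)) _ _ cA Ux.
Qed.

Lemma level_dom x : level e x -> dom A x /\ dom A' x.
Proof.
move=> /(_ _ half_e) Ux; have spe := sp (lt_e half_e).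
by split; [exact: kerU_dom cA spe _ Ux | exact: kerU_dom cA' spe _ Ux].
Qed.

Lemma level_op x : level e x -> level e (A x).
Proof.
move=> Lx e' e'e; apply: (kerU_stable cA (sp (lt_e e'e))); last exact: Lx.
by have [] := level_dom Lx.
Qed.

Lemma level_adjoint x : level e x -> level e (A' x).
Proof.
move=> Lx e' e'e; apply: (kerU_stable cA' (sp (lt_e e'e))); last exact: Lx.
by have [] := level_dom Lx.
Qed.

Lemma level_intertwine (B : H -> H) M x :
  (forall y, rnorm (B y) <= M * rnorm y) ->
  (forall y, dom A' y -> dom A (B y) /\ A (B y) = B (A' y)) ->
  level e x -> level e (B x).
Proof.
move=> BM BA Lx e' /andP[e'0 e'e].
(* [B] costs an arbitrarily small loss of level, from [e2] to [e'] *)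
pose e2 := (e' + e) / 2.
have e2e : 0 < e2 < e by rewrite /e2; lra.
have e'2 : e' < e2 by rewrite /e2; lra.
have e'e' : 0 < e' < e by rewrite e'0.
apply: (kerU_intertwine dot_norm e'0 e'2 _ (sp (lt_e e2e)) (sp (lt_e e'e')) cA cA' BM BA).
  by have /andP[] := lt_e e2e.
exact: Lx.
Qed.

Lemma level_closed : closed_rel (fun x y => level e x /\ y = 0).
Proof.
split.
- by split=> // e' /lt_e /sp s; rewrite (rlinear0 (split_linU s)).
- move=> a x y x' y' [Lx ->] [Lx' ->]; rewrite scaler0 addr0; split=> // e' e'e.
  by have s := sp (lt_e e'e); rewrite (split_linU s) Lx // Lx' // scaler0 addr0.
- move=> u v x y uv ux vy; split; last first.
    apply: rcvg_uniq vy _.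
    have -> : v = fun=> 0 by apply/funext => n; have [] := uv n.
    exact: cvg_cst.
  move=> e' e'e; have s := sp (lt_e e'e); apply/esym.
  apply: (closed_rel_lim (closed_rel_graph (split_linU s) (split_bndU s)) _ ux (v := fun=> 0)).
    by move=> n; have [/(_ _ e'e) ->] := uv n.
  exact: cvg_cst.
Qed.

Lemma level_projection x :
  exists p, level e p /\ forall l, level e l -> << x - p, l >> = 0.
Proof.
have [p [_ [[Lp ->] h]]] := nearest_point dot_norm x level_closed.
by exists p; split=> // l Ll; rewrite (h l 0) // rdot0l.
Qed.

Lemma level_perp_kerV x : (forall l, level e l -> << x, l >> = 0) -> V e x = 0.
Proof.
move=> xL; apply: (rdot_ext dot_norm) => z.
rewrite (split_symV (sp e01)) rdot0l xL //.
by apply: kerU_level; exact: split_UV (sp e01) z.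
Qed.

Lemma level_perp_op x : dom A x -> (forall l, level e l -> << x, l >> = 0) ->
  forall l, level e l -> << A x, l >> = 0.
Proof.
move=> Ax xL l Ll; rewrite rdot_adjoint //; last by have [] := level_dom Ll.
by apply: xL; exact: level_adjoint.
Qed.

End Level.

(** The components of a fixed vector [v] on the complements of the levels tend to [0]
    with [e]: their inner products with vectors [q] of these complements are at
    most [r |q|]. For [w] in the domain of [A], the component [s] of [w] on the
    complement satisfies [|s|^2 <= e (|w|^2 + |A w|^2)], and such [w] are dense. *)
Lemma level_perp_small v (r : R) : 0 < r -> exists e0, 0 < e0 /\
  forall e, 0 < e < 1 -> e <= e0 ->
  forall q, (forall l, level e l -> << q, l >> = 0) -> `|<< v, q >>| <= r * rnorm q.
Proof.
move=> r0; have r2 : 0 < r / 2 by rewrite divr_gt0.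
have [w [Aw vw]] := dense_approx v dA r2.
pose N := << w, w >> + << A w, A w >>.
have N0 : 0 <= N by rewrite addr_ge0 ?(rdot_ge0 dot_norm).
exists ((r / 2) ^+ 2 / (N + 1)); split; first by rewrite divr_gt0 ?exprn_gt0 // ltr_wpDl.
move=> e e01 ee0 q qL.
have [p [Lp pE]] := level_projection e01 w.
set s := w - p in pE.
have [Ap _] := level_dom e01 Lp.
have [As AsE] := closed_relB (compat_closed cA) (conj Aw erefl) (conj Ap erefl).
rewrite -/s in As AsE.
have Vs := level_perp_kerV e01 pE.
have sw : << s, s >> <= << w, w >>.
  by apply: (@pythagoras_le p); [rewrite /s addrC subrK | exact: pE].
have sAw : << A s, A s >> <= << A w, A w >>.
  apply: (@pythagoras_le (A p)); first by rewrite -AsE addrC subrK.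
  by apply: (level_perp_op e01 As pE); exact: level_op.
have sN := kerV_bound cA (sp e01) As Vs.
have s_le : rnorm s <= r / 2.
  apply: (rnorm_sq_le dot_norm); first exact: ltW.
  apply: (le_trans sN).
  have /andP[e0 _] := e01.
  apply: (@le_trans _ _ (e * (N + 1))); first by rewrite ler_pM2l // /N; lra.
  by rewrite -ler_pdivlMr // ltr_wpDl.
have -> : << v, q >> = << v - w, q >> + << s, q >>.
  have : << q, p >> = 0 by exact: qL.
  by rewrite rdotC /s !rdotE => ->; ring.
apply: le_trans (ler_normD _ _) _.
have q0 := rnorm_ge0 q.
have h1 := rdot_CS dot_norm (v - w) q; have h2 := rdot_CS dot_norm s q.
have h3 := ler_wpM2r q0 (ltW vw); have h4 := ler_wpM2r q0 s_le.
lra.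
Qed.

End ReducingSubspaces.

(** * Maximality *)

Section Maximality.
Variables (R : realType) (H : completeNormedModType R[i]).
Variable dot : {dot H for Num.conj}.
Hypothesis dot_norm : induces_norm dot.
Local Notation "<< x , y >>" := (rdot dot x y).
Variables A B T : operator H.
Local Notation A' := (adjoint dot A).
Hypotheses (Al : linear_operator A) (Bl : linear_operator B) (Tl : linear_operator T).
Hypotheses (An : normal_operator dot A) (Bb : bounded_operator B).
Hypotheses (Bs : selfadjoint dot B) (Ts : selfadjoint dot T).
Hypothesis TAB : opsub T (opmul A B).

Lemma selfadjoint_rdot S x y : selfadjoint dot S -> dom S x -> dom S y ->
  << S x, y >> = << x, S y >>.
Proof.
move=> [_ [SS SE]] Sx Sy; rewrite rdot_adjoint //; last by rewrite -SS.
by rewrite -SE.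
Qed.

Lemma selfadjoint_char S y z : linear_operator S -> selfadjoint dot S ->
  (forall x, dom S x -> << S x, y >> = << x, z >>) -> dom S y /\ S y = z.
Proof.
move=> Sl [dS [SS SE]] h; have [Sy Syz] := adjoint_char dot_norm Sl dS h.
by rewrite -SS in Sy; split=> //; rewrite SE.
Qed.

Let Bdom x : dom B x. Proof. by case: Bb => ->. Qed.

Let dA : densely_defined A. Proof. by case: An. Qed.

(** The inclusion [B A^* `<=` T], by taking adjoints in the inclusion [T `<=` A B]. *)
Lemma adjoint_product_sub x : dom A' x -> dom T x /\ T x = B (A' x).
Proof.
move=> A'x; apply: selfadjoint_char => // y Ty.
have [/(_ y Ty) [_ /= AB] /(_ y Ty) /= ->] := TAB.
by rewrite rdot_adjoint // (selfadjoint_rdot Bs).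
Qed.

Lemma intertwining x : dom A' x -> dom A (B x) /\ A (B x) = B (A' x).
Proof.
move=> A'x; have [Tx <-] := adjoint_product_sub A'x.
by have [/(_ x Tx) [_ /= AB] /(_ x Tx) /= ->] := TAB.
Qed.

(** With [x = p + q], where [p] is the projection of [x] on [L_e], both sides agree
    at [p], and what is left is small by [level_perp_small], because [q] and
    [A (B q)] are orthogonal to [L_e] and bounded independently of [e]. *)
Lemma product_symmetric x y : dom A (B x) -> dom T y ->
  << T y, x >> = << y, A (B x) >>.
Proof.
move=> ABx Ty.
have cA : closed_operator A by case: An.
have [Q QP] := resolvent_exists dot_norm Al dA cA.
have Ql := resolvent_linear dot_norm Al An QP.
have Q1 := resolvent_contraction dot_norm QP.
have Qs := resolvent_symmetric QP.
have cpA := compatible_normal dot_norm Al An QP.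
have cpA' := compatible_adjoint dot_norm Al An QP.
have : forall e, exists UV : (H -> H) * (H -> H),
    0 < e < 1 -> splitting dot Q e UV.1 UV.2.
  move=> e; have [e01|_] := boolP (0 < e < 1); last by exists (id, id).
  by have [U [V UV]] := splitting_exists dot_norm Ql Q1 Qs e01; exists (U, V).
move=> /choice [UV sp].
pose U e := (UV e).1; pose V e := (UV e).2.
have {}sp e : 0 < e < 1 -> splitting dot Q e (U e) (V e) by exact: sp.
have [_ [M BM']] := Bb.
have BM z : rnorm (B z) <= M * rnorm z.
  by have := BM' z; rewrite !normE -rmorphM /= lecR.
have Brl : rlinear B by move=> a u v; case: Bl => _ _; apply.
apply/subr0_eq/eqP; rewrite -normr_le0; apply/ler_addgt0Pl => r r0.
rewrite addr0.
pose c := rnorm x + rnorm (A (B x)) + 1.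
have c0 : 0 < c by rewrite ltr_wpDl // addr_ge0 ?rnorm_ge0.
have rc : 0 < r / c by rewrite divr_gt0.
have [e1 [e10 h1]] := level_perp_small dot_norm dA Ql Q1 cpA cpA' sp (T y) rc.
have [e2 [e20 h2]] := level_perp_small dot_norm dA Ql Q1 cpA cpA' sp y rc.
pose e := Num.min (2^-1) (Num.min e1 e2).
have e01 : 0 < e < 1.
  rewrite /e !lt_min e10 e20 invr_gt0 ltr0n /= gt_min invf_lt1 ?ltr0n // ltr1n //.
have ee1 : e <= e1 by rewrite /e !ge_min lexx !orbT.
have ee2 : e <= e2 by rewrite /e !ge_min lexx !orbT.
have [p [Lp pE]] := level_projection dot_norm sp e01 x.
set q := x - p in pE.
have [_ A'p] := level_dom cpA cpA' sp e01 Lp.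
have [Tp TpE] := adjoint_product_sub A'p.
have [ABp ABpE] := intertwining A'p.
have LB l := level_intertwine dot_norm cpA cpA' sp e01 BM intertwining (x := l).
have [ABq ABqE] := closed_relB (compat_closed cpA) (conj ABx erefl) (conj ABp erefl).
have BqE : B x - B p = B q by rewrite -rlinearB.
rewrite BqE in ABq ABqE.
have BqL l : level U e l -> << B q, l >> = 0.
  by move=> Ll; rewrite (selfadjoint_rdot Bs) // pE //; exact: LB.
have ABqL := level_perp_op cpA cpA' sp e01 ABq BqL.
have xpq : x = p + q by rewrite /q addrC subrK.
have q_le : rnorm q <= rnorm x.
  apply: (rnorm_sq_le dot_norm); first exact: rnorm_ge0.
  by rewrite -(rdotxx dot_norm); apply: (pythagoras_le dot_norm xpq); exact: pE.
have ABq_le : rnorm (A (B q)) <= rnorm (A (B x)).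
  apply: (rnorm_sq_le dot_norm); first exact: rnorm_ge0.
  rewrite -(rdotxx dot_norm); apply: (@pythagoras_le _ _ _ dot_norm (A (B p))).
    by rewrite -ABqE addrC subrK.
  apply: ABqL; apply: (level_op cpA cpA' sp e01); exact: LB.
have -> : << T y, x >> - << y, A (B x) >> = << T y, q >> - << y, A (B q) >>.
  have hp : << T y, p >> = << y, A (B p) >>.
    by rewrite (selfadjoint_rdot Ts) // TpE ABpE.
  by rewrite /q -ABqE !rdotE hp; ring.
apply: le_trans (ler_normB _ _) _.
have k1 := h1 e e01 ee1 q pE; have k2 := h2 e e01 ee2 _ ABqL.
apply: le_trans (lerD k1 k2) _.
rewrite -mulrDr mulrAC ler_pdivrMr // ler_pM2l // /c; lra.
Qed.

Lemma product_sub x : dom A (B x) -> dom T x.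
Proof.
move=> ABx; have [] // := @selfadjoint_char T x (A (B x)) Tl Ts.
by move=> y Ty; exact: product_symmetric.
Qed.

End Maximality.

Theorem corollary3p12 (R : realType) (H : completeNormedModType R[i])
    (dot : {dot H for Num.conj}) (dot_norm : induces_norm dot)
    (A B T : operator H)
    (A_linear : linear_operator A) (B_linear : linear_operator B)
    (T_linear : linear_operator T)
    (A_normal : normal_operator dot A)
    (B_bounded : bounded_operator B) (B_selfadjoint : selfadjoint dot B)
    (T_selfadjoint : selfadjoint dot T) :
  opsub T (opmul A B) -> opeq T (opmul A B).
Proof.
move=> TAB; split; last by case: TAB.
apply/seteqP; split; first by case: TAB.
by move=> x [_ ABx]; exact: product_sub ABx.
Qed.
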